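(* Let $n\in\mathbb{N}$, $i\in\{0,1,\dots,n-1\}$, let $H$ be an $i$-dimensional linear subspace of $\mathbb{R}^n$, let $\mathcal{B}=\mathcal{K}^n$ or $\mathcal{B}=\mathcal{K}^n_n$, and let $\diamondsuit:\mathcal{B}\to\mathcal{B}_H$ be a monotonic symmetrization which is invariant on $H$-symmetric sets and mean width preserving. If, in addition, $\diamondsuit$ is canonical, then $\diamondsuit$ is invariant under translations orthogonal to $H$ of $H$-symmetric sets, i.e. $\diamondsuit(K+x)=K$ for all $K\in\mathcal{B}_H$ and all $x\in H^\perp$.
   Context: $\mathcal{K}^n$ is the family of all nonempty compact convex subsets of $\mathbb{R}^n$, and $\mathcal{K}^n_n$ is the family of those with nonempty interior (convex bodies). For a linear subspace $H$, $A|H$ is the orthogonal projection of the set or point $A$ onto $H$, and $H^\perp$ is the orthogonal complement of $H$. A set is $H$-symmetric if it is invariant under the reflection in $H$, $x\mapsto 2(x|H)-x$. For $\mathcal{B}\in\{\mathcal{K}^n,\mathcal{K}^n_n\}$, $\mathcal{B}_H$ is the family of all $H$-symmetric members of $\mathcal{B}$; write $\mathcal{K}^n_H$, $\mathcal{K}^n_{n,H}$ in the two cases. A symmetrization is any map $\diamondsuit:\mathcal{B}\to\mathcal{B}_H$. $B_2^n$ is the closed Euclidean unit ball of $\mathbb{R}^n$ centred at the origin. $\diamondsuit$ is monotonic if $K,L\in\mathcal{B}$, $K\subseteq L$ imply $\diamondsuit K\subseteq\diamondsuit L$. It is invariant on $H$-symmetric sets if $\diamondsuit K=K$ for all $K\in\mathcal{B}_H$.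 It is mean width preserving (equivalently $V_1$-preserving) if $W(\diamondsuit K)=W(K)$ for all $K\in\mathcal{B}$, where $W(K)=2\int_{\mathbb{S}^{n-1}}h_K(u)\,d\sigma(u)$, $h_K(u)=\max_{y\in K}\langle u,y\rangle$ is the support function, and $\sigma$ is the rotation-invariant probability measure on the unit sphere $\mathbb{S}^{n-1}$. Canonical: a symmetrization $\diamondsuit:\mathcal{K}^n\to\mathcal{K}^n_H$ is canonical if it maps every line segment contained in a translate of $H^\perp$ to a line segment. A symmetrization $\diamondsuit:\mathcal{K}^n_n\to\mathcal{K}^n_{n,H}$ is canonical if its natural extension $\overline{\diamondsuit}:\mathcal{K}^n\to\mathcal{K}^n_H$, $\overline{\diamondsuit}K=\bigcap_{m=1}^\infty\diamondsuit\left(K+\frac1m B_2^n\right)$, is canonical. *)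

(* Defs.v *)
From HB Require Import structures.
From mathcomp Require Import all_boot all_order all_algebra.
From mathcomp Require Import all_classical all_reals all_analysis.

Set Implicit Arguments.
Unset Strict Implicit.
Unset Printing Implicit Defensive.

Import Order.TTheory GRing.Theory Num.Theory.
Import numFieldNormedType.Exports.

Local Open Scope classical_set_scope.
Local Open Scope ring_scope.

Section Euclidean.
Variables (R : realType) (n : nat).
Local Notation V := 'rV[R]_n.
Implicit Types (x y u v : V) (A K : set V) (H : {vspace V}).

(* The library norm `|x| on row vectors is the sup norm; it induces the usual
   topology, but lengths below are taken with respect to [dot]. *)
Definition dot u v : R := (u *m v^T) 0 0.

Lemma dotE u v : dot u v = \sum_(j < n) u 0 j * v 0 j.
Proof. by rewrite /dot mxE; apply: eq_bigr => j _; rewrite mxE. Qed.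

Definition eucl_norm x : R := Num.sqrt (dot x x).

Definition eucl_ball : set V := [set x | eucl_norm x <= 1].

Definition eucl_sphere : set V := [set x | eucl_norm x = 1].

Lemma dotC u v : dot u v = dot v u.
Proof. by rewrite !dotE; apply: eq_bigr => j _; rewrite mulrC. Qed.

Lemma dot_linearP u a x y : dot u (a *: x + y) = a * dot u x + dot u y.
Proof. by rewrite /dot linearP mulmxDr -scalemxAr !mxE. Qed.

Lemma dot_eq0 x : dot x x = 0 -> x = 0.
Proof.
rewrite dotE => /eqP; rewrite psumr_eq0 => [/allP x0|j _]; last first.
  by rewrite -expr2 sqr_ge0.
apply/rowP => j; apply/eqP; rewrite mxE.
by have := x0 j (mem_index_enum j); rewrite mulf_eq0 orbb.
Qed.

Definition dot_basis H x : 'rV[R]_(\dim H) :=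
  \row_(i < \dim H) dot (vbasis H)`_i x.

Fact dot_basis_linear H : linear (dot_basis H).
Proof. by move=> a x y; apply/rowP => i; rewrite !mxE dot_linearP. Qed.

HB.instance Definition _ H :=
  GRing.isLinear.Build R V 'rV[R]_(\dim H) *:%R (dot_basis H)
    (dot_basis_linear H).

Definition orth_compl H : {vspace V} := lker (linfun (dot_basis H)).

Lemma memv_orth_complP H x :
  reflect (forall h, h \in H -> dot h x = 0) (x \in orth_compl H).
Proof.
rewrite memv_ker lfunE /=; apply: (iffP eqP) => [x0 h hH|x0].
  rewrite (coord_vbasis hH) dotC (big_morph (dot x) (id1 := 0) (op1 := +%R)).
  - apply: big1 => i _.
    have := dot_linearP x (coord (vbasis H) i h) (vbasis H)`_i 0.
    rewrite addr0 => ->.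
    move/rowP: x0 => /(_ i); rewrite !mxE dotC => ->.
    by rewrite mulr0 /dot trmx0 mulmx0 mxE addr0.
  - by move=> a b; have := dot_linearP x 1 a b; rewrite scale1r mul1r.
  - by rewrite /dot trmx0 mulmx0 mxE.
apply/rowP => i; rewrite !mxE; apply: x0.
by apply: vbasis_mem; apply: mem_nth; rewrite size_tuple.
Qed.

Lemma capv_orth_compl H : (H :&: orth_compl H = 0)%VS.
Proof.
apply/eqP; rewrite -subv0; apply/subvP => x; rewrite memv_cap memv0.
by case/andP => xH /memv_orth_complP/(_ _ xH)/dot_eq0 ->.
Qed.

Lemma addv_orth_compl H : (H + orth_compl H = fullv)%VS.
Proof.
apply/eqP; rewrite -dimv_leqif_eq ?subvf// eqn_leq dimvS ?subvf//=.
rewrite dimv_disjoint_sum ?capv_orth_compl//.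
rewrite -(limg_ker_dim (linfun (dot_basis H)) fullv) capfv addnC leq_add2r.
by apply: leq_trans (dimvS (subvf _)) _; rewrite dimvf /dim /= mul1n.
Qed.

Definition orth_proj H : V -> V := daddv_pi H (orth_compl H).

Lemma orth_proj_mem H x : orth_proj H x \in H.
Proof. exact: memv_pi. Qed.

Lemma sub_orth_proj_orth_compl H x : x - orth_proj H x \in orth_compl H.
Proof.
have xHH : x \in (H + orth_compl H)%VS by rewrite addv_orth_compl memvf.
rewrite -{1}(daddv_pi_add (capv_orth_compl H) xHH) addrC addKr.
exact: memv_pi.
Qed.

Definition reflection H x : V := 2 *: orth_proj H x - x.

Definition symmetric_set H A : Prop := [set reflection H x | x in A] = A.

Definition translate A x : set V := [set y + x | y in A].

Definition minkowski_add A B : set V := [set x + y | x in A & y in B].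

Definition dilate (a : R) A : set V := [set a *: x | x in A].

(* A singleton is a (degenerate) line segment. *)
Definition line_segment A : Prop :=
  exists x y, A = [set (1 - t) *: x + t *: y | t in `[0, 1]].

Definition compact_convex A : Prop := [/\ A !=set0, compact A & convex_set A].

Definition convex_body A : Prop := compact_convex A /\ A° !=set0.

End Euclidean.

Arguments eucl_ball R n : clear implicits.
Arguments eucl_sphere R n : clear implicits.

Section MeanWidth.
Variables (R : realType) (n : nat).
Local Notation V := 'rV[R]_n.

Definition borel_space := g_sigma_algebraType (@open V).
HB.instance Definition _ := Measurable.on borel_space.

(* These conditions determine sigma.  All of O(n) is used, because SO(1) is
   trivial and would not determine sigma when n = 1. *)
Definition uniform_on_sphere (sigma : probability borel_space R) : Prop :=
  sigma (eucl_sphere R n) = 1%E /\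
  forall Q : 'M[R]_n, Q *m Q^T = 1%:M ->
  forall A : set V, measurable (A : set borel_space) ->
    sigma ((fun x : V => x *m Q) @^-1` A) = sigma A.

(* [sup] is a maximum on the nonempty compact sets considered here. *)
Definition support_function (K : set V) (u : V) : R :=
  sup [set dot u y | y in K].

Definition mean_width (sigma : probability borel_space R) (K : set V) : R :=
  2 * \int[sigma]_(u in eucl_sphere R n) support_function K u.

End MeanWidth.

Section Symmetrization.
Variables (R : realType) (n : nat).
Local Notation V := 'rV[R]_n.

Inductive body_class := CompactConvexSets | ConvexBodies.

Definition members (F : body_class) : set (set V) :=
  match F with
  | CompactConvexSets => [set K | compact_convex K]
  | ConvexBodies => [set K | convex_body K]
  end.

Definition symmetric_members F (H : {vspace V}) : set (set V) :=
  [set K | members F K /\ symmetric_set H K].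

(* A map on [members F] is a total function on sets, whose values outside
   [members F] are never constrained or used. *)
Implicit Types (F : body_class) (H : {vspace V}) (D : set V -> set V).

Definition symmetrization F H D : Prop :=
  forall K, members F K -> symmetric_members F H (D K).

Definition monotonic_symmetrization F D : Prop :=
  forall K L, members F K -> members F L -> K `<=` L -> D K `<=` D L.

Definition invariant_on_symmetric F H D : Prop :=
  forall K, symmetric_members F H K -> D K = K.

Definition mean_width_preserving F (sigma : probability (borel_space R n) R) D
    : Prop :=
  forall K, members F K -> mean_width sigma (D K) = mean_width sigma K.

Definition natural_extension D (K : set V) : set V :=
  \bigcap_(m in [set m : nat | (0 < m)%N])
    D (minkowski_add K (dilate m%:R^-1 (eucl_ball R n))).

Definition maps_orthogonal_segments H D : Prop :=
  forall K, line_segment K ->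
    (exists a, K `<=` translate [set` orth_compl H] a) -> line_segment (D K).

Definition canonical_symmetrization F H D : Prop :=
  match F with
  | CompactConvexSets => maps_orthogonal_segments H D
  | ConvexBodies => maps_orthogonal_segments H (natural_extension D)
  end.

End Symmetrization.

(* Main.v *)
Require Import Defs.
From mathcomp Require Import all_boot all_order all_algebra.
From mathcomp Require Import all_classical all_reals all_analysis.
From mathcomp Require Import measurable_realfun ring lra.
Import Order.TTheory GRing.Theory Num.Theory.
Import numFieldNormedType.Exports.

Local Open Scope classical_set_scope.
Local Open Scope ring_scope.

Set Implicit Arguments.
Unset Strict Implicit.
Unset Printing Implicit Defensive.

(** Only the translated segments orthogonal to [H] need to be understood.  Let [h]
    be a point of [H] and let [a], [x] be orthogonal to [H].  The image of
    [h + x + [-a, a]] is an [H]-symmetric segment.  By monotonicity it lies in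
    the [H]-symmetric parallelogram [h + [-a, a] + [-x, x]], which is its own
    image, so it has the form [h + [-b, b]] with [b = al a + be x] and
    [|be| <= 1] ([image_segment]).  Replacing [a] by [t a] with [t >= 1] enlarges
    the image and multiplies its mean width by [t]; hence [b] is, up to sign,
    [1 / t] times the corresponding vector, and its [x]-component is at most
    [1 / t] ([image_segment_direction]).  Letting [t] grow shows that [b] is a
    multiple of [a], and the preservation of the mean width leaves only [a] and
    [- a] ([mem_image_segment]).

    An [H]-symmetric set [K] is the union of the segments [[h - a, h + a]] that
    join its points to their mirror images, so [D (K + x)] contains [K].  The two
    sets have the same mean width, and the mean width is strictly monotonic
    ([mean_width_eq_sub]), so they are equal.  Strict monotonicity rests on
    three facts: a point outside a compact convex set is strictly separated from
    it, support functions are Lipschitz, and spherical caps have positive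
    measure ([cap_measure_gt0]), the caps of one radius being exchanged by
    Householder reflections while finitely many of them cover the sphere.

    For convex bodies the same argument applies to the natural extension, which
    is monotonic, preserves the mean width, fixes the symmetric compact convex
    sets and agrees with [D] on convex bodies ([natural_extension_body]).
    Preservation of the mean width passes to the intersection of the decreasing
    sequence of compact sets that defines it, because their support functions
    converge uniformly on the sphere ([support_bigcap]). *)

(** * Euclidean geometry of row vectors *)

Section EuclideanSpace.
Variables (R : realType) (n : nat).
Local Notation V := 'rV[R]_n.
Implicit Types (x y u v w : V) (A K L : set V).

Lemma dotDr u x y : dot u (x + y) = dot u x + dot u y.
Proof. by have := dot_linearP u 1 x y; rewrite scale1r mul1r. Qed.

Lemma dot0r u : dot u 0 = 0.
Proof. by rewrite /dot trmx0 mulmx0 mxE. Qed.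

Lemma dotZr u (a : R) x : dot u (a *: x) = a * dot u x.
Proof. by have := dot_linearP u a x 0; rewrite !addr0 dot0r addr0. Qed.

Lemma dotNr u x : dot u (- x) = - dot u x.
Proof. by rewrite -scaleN1r dotZr mulN1r. Qed.

Lemma dotBr u x y : dot u (x - y) = dot u x - dot u y.
Proof. by rewrite dotDr dotNr. Qed.

Lemma dotDl u x y : dot (x + y) u = dot x u + dot y u.
Proof. by rewrite dotC dotDr !(dotC u). Qed.

Lemma dotZl u (a : R) x : dot (a *: x) u = a * dot x u.
Proof. by rewrite dotC dotZr dotC. Qed.

Lemma dotNl u x : dot (- x) u = - dot x u.
Proof. by rewrite dotC dotNr dotC. Qed.

Lemma dotBl u x y : dot (x - y) u = dot x u - dot y u.
Proof. by rewrite dotDl dotNl. Qed.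

Lemma dot0l u : dot 0 u = 0.
Proof. by rewrite dotC dot0r. Qed.

Definition dot_bilinear := (dotDr, dotDl, dotBr, dotBl, dotZr, dotZl, dotNr, dotNl).

Lemma dot_ge0 x : 0 <= dot x x.
Proof. by rewrite dotE sumr_ge0// => i _; rewrite -expr2 sqr_ge0. Qed.

Lemma dot_gt0 x : x != 0 -> 0 < dot x x.
Proof.
move=> x0; rewrite lt_def dot_ge0 andbT.
by apply: contra_neq x0; exact: dot_eq0.
Qed.

Lemma eucl_norm_ge0 x : 0 <= eucl_norm x.
Proof. exact: sqrtr_ge0. Qed.

Lemma sqr_eucl_norm x : eucl_norm x ^+ 2 = dot x x.
Proof. by rewrite sqr_sqrtr// dot_ge0. Qed.

Lemma le_eucl_norm x (r : R) : 0 <= r -> (eucl_norm x <= r) = (dot x x <= r ^+ 2).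
Proof. by move=> r0; rewrite -sqr_eucl_norm ler_sqr ?nnegrE// eucl_norm_ge0. Qed.

Lemma eucl_sphereP u : eucl_sphere R n u <-> dot u u = 1.
Proof.
rewrite /eucl_sphere/=; split=> [u1|u1]; first by rewrite -sqr_eucl_norm u1 expr1n.
by rewrite /eucl_norm u1 sqrtr1.
Qed.

Lemma cauchy_schwarz u v : `|dot u v| <= eucl_norm u * eucl_norm v.
Proof.
rewrite -ler_sqr ?nnegrE ?mulr_ge0 ?eucl_norm_ge0//.
rewrite exprMn !sqr_eucl_norm real_normK ?num_real//.
have [->|v0] := eqVneq v 0; first by rewrite !dot0r expr0n mulr0.
have v2 := dot_gt0 v0.
(* <v, v> times the component of u orthogonal to v *)
have := dot_ge0 (dot v v *: u - dot u v *: v).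
have -> : dot (dot v v *: u - dot u v *: v) (dot v v *: u - dot u v *: v) =
          dot v v * (dot u u * dot v v - dot u v ^+ 2).
  by rewrite !dot_bilinear (dotC v u); ring.
by rewrite pmulr_rge0// subr_ge0.
Qed.

Lemma dot_le_norm u v : dot u v <= eucl_norm u * eucl_norm v.
Proof. exact: le_trans (ler_norm _) (cauchy_schwarz u v). Qed.

Let coord_continuousV j : continuous (fun x : V => x 0 j).
Proof. exact: (@coord_continuous R 1 n 0 j). Qed.

Lemma dot_continuous u : continuous (dot u).
Proof.
have -> : dot u = fun x => \sum_(j < n) u 0 j * x 0 j.
  by apply/funext => x; rewrite dotE.
apply: continuous_big => [|j _]; first exact: add_continuous.
have cj : continuous (fun x : V => u 0 j * x 0 j).
  move=> x; apply: (@cvgMl_tmp _ _ (nbhs x)); exact: coord_continuousV.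
exact: cj.
Qed.

Lemma dot_diag_continuous : continuous (fun x => dot x x).
Proof.
have -> : (fun x => dot x x) = fun x => \sum_(j < n) x 0 j * x 0 j.
  by apply/funext => x; rewrite dotE.
apply: continuous_big => [|j _]; first exact: add_continuous.
have cj : continuous (fun x : V => x 0 j * x 0 j).
  by move=> x; apply: (@cvgM _ _ (nbhs x)); exact: coord_continuousV.
exact: cj.
Qed.

(** The topology is that of the sup norm, which the Euclidean norm dominates. *)
Lemma coord_le_norm x j : `|x 0 j| <= eucl_norm x.
Proof.
rewrite -ler_sqr ?nnegrE ?eucl_norm_ge0// sqr_eucl_norm real_normK ?num_real//.
rewrite dotE (bigD1 j)//= -expr2 lerDl sumr_ge0// => i _.
by rewrite -expr2 sqr_ge0.
Qed.

Lemma mx_norm_le_norm x : `|x| <= eucl_norm x.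
Proof.
rewrite [leLHS]/Num.norm/= mx_normrE; apply/bigmax_leP; split.
  exact: eucl_norm_ge0.
by move=> [i j] _ /=; rewrite ord1; exact: coord_le_norm.
Qed.

Lemma compact_of_norm_le A (r : R) :
  (forall x, A x -> eucl_norm x <= r) -> closed A -> compact A.
Proof.
move=> Ar cA; apply: bounded_closed_compact => //.
exists r; split; first exact: num_real.
move=> s rs x /Ar xr.
by apply: le_trans (mx_norm_le_norm x) _; rewrite (le_trans xr)// ltW.
Qed.

Lemma compact_norm_bounded K : compact K ->
  exists2 r, 0 < r & forall x, K x -> eucl_norm x <= r.
Proof.
move=> cK; have [->|/set0P K0] := eqVneq K set0; first by exists 1.
have [|c _ cmax] := compact_EVT_max (f := fun x => dot x x) K0 cK.
  exact/continuous_subspaceT/dot_diag_continuous.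
exists (dot c c + 1) => [|x Kx]; first by rewrite ltr_wpDl// dot_ge0.
have c0 := dot_ge0 c.
rewrite le_eucl_norm ?addr_ge0//.
apply: (le_trans (cmax _ (mem_set Kx))).
by rewrite -subr_ge0; nra.
Qed.

Lemma closed_compact K : compact K -> closed K.
Proof. by apply: compact_closed; exact: norm_hausdorff. Qed.

Lemma convex_setE A : convex_set A <->
  forall x y (t : R), 0 <= t <= 1 -> A x -> A y -> A (t *: x + (1 - t) *: y).
Proof.
split=> [cA x y t t01 Ax Ay|cA x y l].
  have := cA x y (Itv01 (proj1 (andP t01)) (proj2 (andP t01))).
  by move=> /(_ (mem_set Ax) (mem_set Ay))/set_mem.
move=> /set_mem Ax /set_mem Ay; apply/mem_set.
by apply: cA => //; rewrite ge0 le1.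
Qed.

Lemma compact_sphere : compact (eucl_sphere R n).
Proof.
apply: (@compact_of_norm_le _ 1) => [x ->//|].
have -> : eucl_sphere R n = (fun x => dot x x) @^-1` [set 1].
  by apply/seteqP; split=> x /eucl_sphereP.
apply: preimage_closed => [x _|]; first exact: dot_diag_continuous.
exact: closed_eq.
Qed.

Lemma compact_ball : compact (eucl_ball R n).
Proof.
apply: (@compact_of_norm_le _ 1) => //.
have -> : eucl_ball R n = (fun x => dot x x) @^-1` [set r | r <= 1].
  by apply/seteqP; split=> x; rewrite /eucl_ball/= le_eucl_norm// expr1n.
apply: preimage_closed => [x _|]; first exact: dot_diag_continuous.
exact: closed_le.
Qed.

Lemma convex_ball : convex_set (eucl_ball R n).
Proof.
apply/convex_setE => x y t /andP[t0 t1]; rewrite /eucl_ball/=.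
move=> x1 y1; rewrite le_eucl_norm// expr1n.
have xy : dot x y <= 1.
  rewrite (le_trans (dot_le_norm _ _))//.
  by rewrite mulr_ile1// eucl_norm_ge0.
move: x1 y1; rewrite !le_eucl_norm// expr1n => x1 y1.
rewrite !dot_bilinear (dotC y x) -subr_ge0.
rewrite [leRHS](_ : _ = t ^+ 2 * (1 - dot x x) +
    2 * (t * (1 - t)) * (1 - dot x y) + (1 - t) ^+ 2 * (1 - dot y y)); last ring.
by rewrite !addr_ge0 ?mulr_ge0 ?sqr_ge0 ?subr_ge0.
Qed.

End EuclideanSpace.

(** * Support functions, separation and compact convex sets *)

Section ConvexGeometry.
Variables (R : realType) (n : nat).
Local Notation V := 'rV[R]_n.
Implicit Types (x y z u v : V) (A B K L : set V) (H : {vspace V}).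

Lemma sub_support K u (r : R) : K !=set0 -> (forall y, K y -> dot u y <= r) ->
  support_function K u <= r.
Proof.
move=> [y0 Ky0] Kr; apply: ge_sup => [|_ [y Ky <-]]; last exact: Kr.
by exists (dot u y0), y0.
Qed.

Lemma support_attained K u : K !=set0 -> compact K ->
  exists y, [/\ K y, support_function K u = dot u y &
                forall z, K z -> dot u z <= dot u y].
Proof.
move=> K0 cK; have [|y Ky ymax] := compact_EVT_max (f := dot u) K0 cK.
  exact/continuous_subspaceT/dot_continuous.
have {}ymax z : K z -> dot u z <= dot u y by move=> /mem_set/ymax.
exists y; split=> //; first exact/set_mem.
apply/eqP; rewrite eq_le sub_support//=; apply: ub_le_sup.
  by exists (dot u y) => _ [z Kz <-]; exact: ymax.
by exists y => //; exact/set_mem.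
Qed.

Lemma dot_le_support K u y : compact K -> K y -> dot u y <= support_function K u.
Proof.
move=> cK Ky; have K0 : K !=set0 by exists y.
by have [z [_ -> zmax]] := support_attained u K0 cK; exact: zmax.
Qed.

Lemma support_le K L u : K !=set0 -> compact L -> K `<=` L ->
  support_function K u <= support_function L u.
Proof. by move=> K0 cL KL; apply: sub_support => // y /KL/dot_le_support; exact. Qed.

Lemma support_translate K x u : K !=set0 -> compact K ->
  support_function (translate K x) u = support_function K u + dot u x.
Proof.
move=> K0 cK; have [y [Ky -> ymax]] := support_attained u K0 cK.
apply/eqP; rewrite eq_le; apply/andP; split.
  apply: sub_support => [|_ [z Kz <-]]; first by exists (y + x), y.
  by rewrite dotDr lerD2r ymax.
apply: ub_le_sup; last by exists (y + x); rewrite ?dotDr//; exists y.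
by exists (dot u y + dot u x) => _ [_ [z Kz <-] <-]; rewrite dotDr lerD2r ymax.
Qed.

Lemma support_dilate K (a : R) u : 0 <= a -> K !=set0 -> compact K ->
  support_function (dilate a K) u = a * support_function K u.
Proof.
move=> a0 K0 cK; have [y [Ky -> ymax]] := support_attained u K0 cK.
apply/eqP; rewrite eq_le; apply/andP; split.
  apply: sub_support => [|_ [z Kz <-]]; first by exists (a *: y), y.
  by rewrite dotZr ler_wpM2l// ymax.
apply: ub_le_sup; last by exists (a *: y); rewrite ?dotZr//; exists y.
by exists (a * dot u y) => _ [_ [z Kz <-] <-]; rewrite dotZr ler_wpM2l// ymax.
Qed.

Lemma support_add_ball K (a : R) u : 0 <= a -> eucl_sphere R n u ->
  K !=set0 -> compact K ->
  support_function (minkowski_add K (dilate a (eucl_ball R n))) u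
    <= support_function K u + a.
Proof.
move=> a0 u1 [y Ky] cK; apply: sub_support => [|_ [z Kz] [_ [b b1 <-] <-]].
  exists (y + a *: 0), y => //; exists (a *: 0) => //; exists 0 => //.
  by rewrite /eucl_ball/= /eucl_norm dot0l sqrtr0.
rewrite dotDr lerD ?dot_le_support// dotZr ler_piMr//.
by rewrite (le_trans (dot_le_norm _ _))// u1 mul1r.
Qed.

(** The outer normal is the vector from the nearest point of [K] to [z]: a step
    from that point towards any [y] in [K] would otherwise decrease the
    distance to [z]. *)
Lemma strict_separation K z : compact_convex K -> ~ K z ->
  exists2 u, eucl_sphere R n u & support_function K u < dot u z.
Proof.
move=> [K0 cK /convex_setE vK] Kz.
have [|c /set_mem Kc cmin] := compact_EVT_min (f := fun y => dot (z - y) (z - y)) K0 cK.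
  apply: continuous_subspaceT => y.
  apply: (@continuous_comp _ _ _ (fun y => z - y) (fun y => dot y y)).
    by apply: (@cvgB _ _ _ (nbhs y)); [exact: cvg_cst|exact: cvg_id].
  exact: dot_diag_continuous.
pose v := z - c.
have v0 : v != 0 by rewrite subr_eq0; apply/eqP => zc; apply: Kz; rewrite zc.
have vK_le y : K y -> dot v y <= dot v c.
  move=> Ky; rewrite leNgt; apply/negP => vcy.
  pose p := dot v (y - c); pose q := dot (y - c) (y - c).
  have p0 : 0 < p by rewrite /p dotBr subr_gt0.
  have q0 : 0 <= q by exact: dot_ge0.
  (* a step t with 0 < t <= 1 and t q < 2 p decreases the distance *)
  pose t := p / (p + q).
  have pq : 0 < p + q by rewrite ltr_wpDr.
  have t0 : 0 < t by rewrite divr_gt0.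
  have t1 : t <= 1 by rewrite ler_pdivrMr// mul1r lerDl.
  have Kt : K (t *: y + (1 - t) *: c) by apply: vK => //; rewrite t1 ltW.
  have := cmin _ (mem_set Kt).
  have -> : z - (t *: y + (1 - t) *: c) = v - t *: (y - c).
    by rewrite /v; apply/rowP => j; rewrite !mxE; ring.
  have -> : dot (v - t *: (y - c)) (v - t *: (y - c)) =
            dot v v - t * (2 * p - t * q).
    by rewrite /p /q; move: (y - c) (v) => w v'; rewrite !dot_bilinear (dotC w); ring.
  rewrite lerBrDr gerDl pmulr_rle0// subr_le0 => tq.
  have : (2 * p) * (p + q) <= p * q.
    have -> : p * q = t * q * (p + q) by rewrite /t; field; rewrite gt_eqF.
    by rewrite ler_pM2r.
  by nra.
have N0 : 0 < eucl_norm v by rewrite sqrtr_gt0 dot_gt0.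
exists ((eucl_norm v)^-1 *: v).
  apply/eucl_sphereP; rewrite dotZl dotZr -sqr_eucl_norm; field.
  by rewrite gt_eqF.
apply: (@le_lt_trans _ _ (dot ((eucl_norm v)^-1 *: v) c)).
  by apply: sub_support => // y Ky; rewrite !dotZl ler_wpM2l ?vK_le// invr_ge0 ltW.
by rewrite !dotZl ltr_pM2l ?invr_gt0// -subr_gt0 -dotBr dot_gt0.
Qed.

Lemma compact_image (f : V -> V) K : continuous f -> compact K -> compact (f @` K).
Proof.
by move=> fc cK; apply: continuous_compact => //; exact: continuous_subspaceT.
Qed.

Lemma compact_convex_translate K x : compact_convex K -> compact_convex (translate K x).
Proof.
move=> [[y Ky] cK /convex_setE vK]; split; first by exists (y + x), y.
  apply: compact_image cK => z.
  by apply: (@cvgD _ _ _ (nbhs z)); [exact: cvg_id|exact: cvg_cst].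
apply/convex_setE => _ _ t t01 [y1 Ky1 <-] [y2 Ky2 <-].
exists (t *: y1 + (1 - t) *: y2); first exact: vK.
by apply/rowP => j; rewrite !mxE; ring.
Qed.

Lemma compact_convex_dilate K (a : R) : compact_convex K -> compact_convex (dilate a K).
Proof.
move=> [[y Ky] cK /convex_setE vK]; split; first by exists (a *: y), y.
  by apply: compact_image cK; exact: scaler_continuous.
apply/convex_setE => _ _ t t01 [y1 Ky1 <-] [y2 Ky2 <-].
exists (t *: y1 + (1 - t) *: y2); first exact: vK.
by apply/rowP => j; rewrite !mxE; ring.
Qed.

Lemma compact_convex_add K L : compact_convex K -> compact_convex L ->
  compact_convex (minkowski_add K L).
Proof.
move=> [[x Kx] cK /convex_setE vK] [[y Ly] cL /convex_setE vL]; split.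
- by exists (x + y), x => //; exists y.
- have -> : minkowski_add K L = (fun p : V * V => p.1 + p.2) @` (K `*` L).
    apply/seteqP; split=> [_ [p Kp] [q Lq] <-|_ [[p q] [Kp Lq] <-]].
      by exists (p, q).
    by exists p => //; exists q.
  apply: continuous_compact; last exact: compact_setX.
  by apply: continuous_subspaceT; exact: add_continuous.
- apply/convex_setE => _ _ t t01 [x1 Kx1 [y1 Ly1 <-]] [x2 Kx2 [y2 Ly2 <-]].
  exists (t *: x1 + (1 - t) *: x2); first exact: vK.
  exists (t *: y1 + (1 - t) *: y2); first exact: vL.
  by apply/rowP => j; rewrite !mxE; ring.
Qed.

Definition centered_segment x : set V := [set s *: x | s in `[(-1 : R), 1]].

Lemma centered_segmentP x y :
  centered_segment x y <-> exists2 s : R, -1 <= s <= 1 & y = s *: x.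
Proof.
by split=> [[s /=]|[s s1 ->]]; [rewrite in_itv/= => s1 <-; exists s|
  exists s; rewrite //= in_itv].
Qed.

Lemma compact_convex_segment x : compact_convex (centered_segment x).
Proof.
split.
- by exists (0 *: x); apply/centered_segmentP; exists 0; rewrite ?lerN10 ?ler01.
- apply: continuous_compact; last exact: segment_compact.
  by apply: continuous_subspaceT; exact: scalel_continuous.
- apply/convex_setE => y z t /andP[t0 t1].
  move=> /centered_segmentP[r /andP[r0 r1] ->] /centered_segmentP[s /andP[s0 s1] ->].
  apply/centered_segmentP; exists (t * r + (1 - t) * s); last first.
    by apply/rowP => j; rewrite !mxE; ring.
  by apply/andP; split; nra.
Qed.

Lemma compact_convex_ball : compact_convex (eucl_ball R n).
Proof.
split; [|exact: compact_ball|exact: convex_ball].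
by exists 0; rewrite /eucl_ball/= /eucl_norm dot0l sqrtr0.
Qed.

Lemma compact_convex_bigcap (K_ : nat -> set V) : (forall k, compact_convex (K_ k)) ->
  \bigcap_k K_ k !=set0 -> compact_convex (\bigcap_k K_ k).
Proof.
move=> cK K0; split=> //.
  have clK k : closed (K_ k) by have [_ /closed_compact] := cK k.
  have [_ cK0 _] := cK 0; apply: subclosed_compact cK0 _.
    by apply: closed_bigI => k _; exact: clK.
  by move=> y; apply.
apply/convex_setE => x y t t01 Kx Ky k _.
by have [_ _ /convex_setE vK] := cK k; apply: vK => //; [exact: Kx|exact: Ky].
Qed.

(** Otherwise [U] and the complements of the [K_ k] would form an open cover of
    [K_ 0] without finite subcover. *)
Lemma decreasing_compact (K_ : nat -> set V) (U : set V) :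
  (forall k, compact (K_ k)) -> (forall j k, (j <= k)%N -> K_ k `<=` K_ j) ->
  open U -> \bigcap_k K_ k `<=` U -> exists k, K_ k `<=` U.
Proof.
move=> cK dK oU KU.
have := cK 0; rewrite compact_cover.
move=> /(_ nat setT (fun k => U `|` ~` K_ k)) [k _||D' _ D'cov].
- by apply: openU => //; apply: closed_openC; exact: closed_compact.
- move=> x _; have [Ux|Ux] := pselect (U x); first by exists 0 => //; left.
  have : ~ (\bigcap_k K_ k) x by move=> /KU.
  by move=> /existsNP[k] /not_implyP[_ Kx]; exists k => //; right.
exists (\max_(k <- finmap.enum_fset D') k)%N => x Kx.
have [j D'j [//|]] := D'cov x (dK 0 _ (leq0n _) x Kx).
by case; apply: dK Kx; apply: leq_bigmax_seq.
Qed.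

(** The convergence is uniform on the sphere because some [K_ k] lies in the
    open [eps]-neighbourhood of the intersection. *)
Lemma support_bigcap (K_ : nat -> set V) (eps : R) :
  (forall k, compact_convex (K_ k)) -> (forall j k, (j <= k)%N -> K_ k `<=` K_ j) ->
  \bigcap_k K_ k !=set0 -> 0 < eps ->
  exists k, forall u, eucl_sphere R n u ->
    support_function (K_ k) u <= support_function (\bigcap_j K_ j) u + eps.
Proof.
move=> cK dK K0 eps0; set L := \bigcap_j K_ j.
have [_ cL _] : compact_convex L by exact: compact_convex_bigcap.
pose U := \bigcup_(y in L) [set x | dot (x - y) (x - y) < eps ^+ 2].
have [||||k KU] := @decreasing_compact K_ U.
- by move=> k; have [] := cK k.
- exact: dK.
- apply: bigcup_open => y _.
  have : open ((fun x => dot (x - y) (x - y)) @^-1` [set r | r < eps ^+ 2]).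
    apply: open_comp; last exact: open_lt.
    move=> x _; apply: (@continuous_comp _ _ _ (fun x => x - y) (fun x => dot x x)).
      by apply: (@cvgB _ _ _ (nbhs x)); [exact: cvg_id|exact: cvg_cst].
    exact: dot_diag_continuous.
  by [].
- by move=> x Lx; exists x => //=; rewrite subrr dot0l exprn_gt0.
exists k => u u1; apply: sub_support => [|x /KU[y Ly /= xy]].
  by have [] := cK k.
rewrite -[x](subrK y) addrC dotDr lerD ?dot_le_support//.
rewrite (le_trans (dot_le_norm _ _))// u1 mul1r le_eucl_norm ?ltW//.
Qed.

End ConvexGeometry.

(** * Spherical caps *)

Section Householder.
Variables (R : realType) (n : nat).
Local Notation V := 'rV[R]_n.
Implicit Types (x y u v w : V).

Lemma dot_mulmx_orthogonal (Q : 'M[R]_n) x y : Q *m Q^T = 1%:M ->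
  dot (x *m Q) (y *m Q) = dot x y.
Proof. by move=> QQ; rewrite /dot trmx_mul mulmxA -(mulmxA x) QQ mulmx1. Qed.

(** Two distinct unit vectors are exchanged by the reflection in the hyperplane
    orthogonal to their difference. *)
Lemma orthogonal_sphere_transitive u v :
  eucl_sphere R n u -> eucl_sphere R n v ->
  exists2 Q : 'M[R]_n, Q *m Q^T = 1%:M & u *m Q = v.
Proof.
move=> /eucl_sphereP u1 /eucl_sphereP v1.
have [<-|uv] := eqVneq u v; first by exists 1%:M; rewrite ?mulmx1// trmx1 mulmx1.
pose w := u - v; have w0 : dot w w != 0.
  by apply: contra_neq uv => /dot_eq0/subr0_eq.
have ww : w *m w^T = (dot w w)%:M by rewrite [LHS]mx11_scalar.
pose c := 2 / dot w w; pose P := w^T *m w.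
have PP : P *m P = dot w w *: P.
  by rewrite /P mulmxA -(mulmxA w^T) ww mul_mx_scalar scalemxAl.
have Pt : P^T = P by rewrite /P trmx_mul trmxK.
have uP : u *m P = dot u w *: w.
  have uw : u *m w^T = (dot u w)%:M by rewrite [LHS]mx11_scalar.
  by rewrite /P mulmxA uw mul_scalar_mx.
clearbody P; exists (1%:M - c *: P).
  have -> : (1%:M - c *: P)^T = 1%:M - c *: P.
    by apply/matrixP => i j; rewrite -[P in LHS]Pt !mxE eq_sym.
  rewrite mulmxBl mul1mx mulmxBr mulmx1.
  rewrite -scalemxAl -scalemxAr PP !scalerA.
  have -> : c * c * dot w w = c + c by rewrite /c; field.
  by apply/matrixP => i j; rewrite !mxE; ring.
rewrite mulmxBr mulmx1 -scalemxAr uP scalerA.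
have -> : c * dot u w = 1.
  move: w0; rewrite /c /w !dot_bilinear (dotC v u) u1 v1 => w0.
  by field; move: w0; apply: contra_neq => <-; ring.
by rewrite scale1r subKr.
Qed.

End Householder.

Section MeanWidthTheory.
Variables (R : realType) (n : nat).
Local Notation V := 'rV[R]_n.
Implicit Types (x y z u v w : V) (A K L : set V).
Local Notation S := (eucl_sphere R n).

Definition cap v (r : R) : set V := S `&` [set u | r < dot u v].

Lemma open_dot_gt v (r : R) : open [set u : V | r < dot u v].
Proof.
have -> : [set u : V | r < dot u v] = dot v @^-1` [set s | r < s].
  by apply/seteqP; split=> u /=; rewrite dotC.
by apply: open_comp; [move=> u _; exact: dot_continuous|exact: open_gt].
Qed.

Lemma borel_open A : open A -> measurable (A : set (borel_space R n)).
Proof. exact: sub_sigma_algebra. Qed.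

Lemma borel_closed A : closed A -> measurable (A : set (borel_space R n)).
Proof.
by move=> cA; rewrite -[A]setCK; apply: measurableC; apply: borel_open; exact: closed_openC.
Qed.

Lemma borel_sphere : measurable (S : set (borel_space R n)).
Proof. by apply: borel_closed; apply: closed_compact; exact: compact_sphere. Qed.

Lemma borel_cap v (r : R) : measurable (cap v r : set (borel_space R n)).
Proof.
by apply: measurableI; [exact: borel_sphere|apply: borel_open; exact: open_dot_gt].
Qed.

Variable sigma : probability (borel_space R n) R.
Hypothesis sigmaU : uniform_on_sphere sigma.

Lemma cap_measure_eq u v (r : R) : S u -> S v -> sigma (cap u r) = sigma (cap v r).
Proof.
move=> u1 v1; have [Q QQ uQ] := orthogonal_sphere_transitive u1 v1.
have [_ /(_ _ QQ _ (borel_cap v r)) <-] := sigmaU; congr (sigma _).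
by apply/seteqP; split=> x; rewrite /cap/= -uQ dot_mulmx_orthogonal// => -[xS xu];
  split=> //; apply/eucl_sphereP; move/eucl_sphereP: xS; rewrite dot_mulmx_orthogonal.
Qed.

(** Caps of a given radius have equal measure, and finitely many of them cover
    the compact sphere. *)
Lemma cap_measure_gt0 v (r : R) : S v -> r < 1 -> (0 < sigma (cap v r))%E.
Proof.
move=> v1 r1; rewrite lt_neqAle measure_ge0 andbT; apply/eqP => cap0.
have := @compact_sphere R n; rewrite compact_cover.
move=> /(_ V S (fun w => [set u | r < dot u w])) [w _||D' sD' D'cov].
- exact: open_dot_gt.
- by move=> u u1; exists u => //=; move/eucl_sphereP: u1 => ->.
have : (sigma S <= \sum_(w \in [set` finmap.enum_fset D']) sigma (cap w r))%E.
  apply: content_sub_fsum => //.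
  - by move=> w _; exact: borel_cap.
  - exact: borel_sphere.
  - by move=> u u1; have [w D'w uw] := D'cov u u1; exists w.
rewrite fsbig1 => [|w /= /sD' wS]; last first.
  by rewrite (cap_measure_eq r (set_mem wS) v1).
by have [-> _] := sigmaU; rewrite lee_fin ler10.
Qed.

End MeanWidthTheory.

(** * Mean width *)

Section MeanWidthProperties.
Variables (R : realType) (n : nat).
Local Notation V := 'rV[R]_n.
Implicit Types (x y z u v w : V) (K L : set V).
Local Notation S := (eucl_sphere R n).
Variable sigma : probability (borel_space R n) R.
Hypothesis sigmaU : uniform_on_sphere sigma.

(** A support function is lower semicontinuous, being a supremum of continuous
    functions. *)
Lemma measurable_support K : K !=set0 -> compact K ->
  measurable_fun (setT : set (borel_space R n)) (support_function K).
Proof.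
move=> K0 cK; apply: (measurability _ (RGenOInfty.measurableE R)).
move=> _ [_ [r ->] <-]; rewrite setTI; apply: borel_open.
have -> : support_function K @^-1` `]r, +oo[%classic =
    \bigcup_(y in K) [set u | r < dot u y].
  apply/seteqP; split=> [u|u [y Ky /= ry]]; rewrite /= in_itv/= andbT.
    by have [y [Ky -> _]] := support_attained u K0 cK; exists y.
  exact: lt_le_trans ry (dot_le_support _ cK Ky).
by apply: bigcup_open => y _; exact: open_dot_gt.
Qed.

Lemma norm_support_le K (r : R) u : K !=set0 -> compact K ->
  (forall y, K y -> eucl_norm y <= r) -> S u -> `|support_function K u| <= r.
Proof.
move=> K0 cK Kr u1; have [y [Ky -> _]] := support_attained u K0 cK.
by rewrite (le_trans (cauchy_schwarz u y))// u1 mul1r Kr.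
Qed.

Lemma integrable_support K : K !=set0 -> compact K ->
  sigma.-integrable S (EFin \o support_function K).
Proof.
move=> K0 cK; apply: measurable_bounded_integrable; first exact: borel_sphere.
- by rewrite (le_lt_trans (probability_le1 _ (borel_sphere (n:=n))))// ltry.
- exact: measurable_funTS (measurable_support K0 cK).
- have [r r0 Kr] := compact_norm_bounded cK.
  exists r; split; first exact: num_real.
  move=> s rs u uS; apply: le_trans (ltW rs).
  by apply: norm_support_le.
Qed.

(** An inequality of support functions up to [e] integrates to one of mean widths
    up to [2 e], as [sigma] has mass one on the sphere. *)
Lemma mean_width_le_add K L (e : R) :
  K !=set0 -> compact K -> L !=set0 -> compact L ->
  (forall u, S u -> support_function K u <= support_function L u + e) ->
  mean_width sigma K <= mean_width sigma L + 2 * e.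
Proof.
move=> K0 cK L0 cL KLe; rewrite /mean_width -mulrDr ler_pM2l//.
have iK := integrable_support K0 cK; have iL := integrable_support L0 cL.
have mS : measurable (S : set (borel_space R n)) by exact: borel_sphere.
have ie : sigma.-integrable S (EFin \o cst e).
  by apply: finite_measure_integrable_cst.
have -> : e = \int[sigma]_(u in S) e.
  have s1 : fine (sigma S) = 1 by have [-> _] := sigmaU.
  by rewrite Rintegral_cst// -[LHS]mulr1; congr (_ * _); exact/esym.
rewrite -RintegralD//; apply: le_Rintegral => //.
have -> : EFin \o (fun u => support_function L u + e) =
  ((EFin \o support_function L) \+ (EFin \o cst e))%E by [].
exact: integrableD.
Qed.

Lemma mean_width_le K L : K !=set0 -> compact K -> compact L -> K `<=` L ->
  mean_width sigma K <= mean_width sigma L.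
Proof.
move=> K0 cK cL KL; rewrite -[leRHS]addr0 -[X in _ + X](mulr0 2).
apply: mean_width_le_add => // [|u _].
  by case: K0 => y /KL; exists y.
by rewrite addr0; exact: support_le.
Qed.

Lemma measurable_dot x :
  measurable_fun (setT : set (borel_space R n)) (fun u : V => dot u x).
Proof.
apply: (measurability _ (RGenOInfty.measurableE R)).
move=> _ [_ [r ->] <-]; rewrite setTI; apply: borel_open.
have -> : (fun u : V => dot u x) @^-1` `]r, +oo[%classic = [set u | r < dot u x].
  by apply/seteqP; split=> u /=; rewrite in_itv/= andbT.
exact: open_dot_gt.
Qed.

Lemma integrable_dot x : sigma.-integrable S (EFin \o (fun u : V => dot u x)).
Proof.
apply: measurable_bounded_integrable; first exact: borel_sphere.
- by rewrite (le_lt_trans (probability_le1 _ (borel_sphere (n:=n))))// ltry.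
- exact: measurable_funTS (measurable_dot x).
- exists (eucl_norm x); split; first exact: num_real.
  move=> s rs u uS; apply: le_trans (ltW rs) => /=.
  by rewrite (le_trans (cauchy_schwarz u x))// uS mul1r.
Qed.

(** The antipodal map preserves [sigma] and changes the sign of the integrand. *)
Lemma integral_dot x : \int[sigma]_(u in S) dot u x = 0.
Proof.
pose phi (u : borel_space R n) : borel_space R n := (u : V) *m (- 1%:M).
have phiE (u : V) : phi u = - u by rewrite /phi mulmxN mulmx1.
have mS : measurable (S : set (borel_space R n)) by exact: borel_sphere.
have mphi : measurable_fun setT phi.
  apply: (@measurability _ _ _ _ _ phi (@open V)) => //.
  move=> _ [A oA <-]; rewrite setTI; apply: borel_open.
  have -> : phi @^-1` A = (fun u : V => - u) @^-1` A.
    by apply/seteqP; split=> u /=; rewrite phiE.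
  by apply: open_comp => // u _; exact: oppr_continuous.
have phiS : phi @^-1` S = S.
  by apply/seteqP; split=> u /=; rewrite phiE /eucl_sphere/= /eucl_norm dotNl dotNr opprK.
have NE (u : V) : dot (phi u) x = - 1 * dot u x by rewrite phiE dotNl mulN1r.
pose f (u : borel_space R n) : R := dot (u : V) x.
have mdot : measurable_fun setT (EFin \o f).
  by apply/measurable_EFinP; exact: measurable_dot.
have intN : sigma.-integrable (phi @^-1` S) ((EFin \o f) \o phi).
  rewrite phiS; apply: eq_integrable (integrableZl mS (-1) (integrable_dot x)) => //.
  by move=> u _ /=; rewrite /f NE EFinM.
have sigmaN := integral_pushforward mphi mdot intN mS.
have : \int[sigma]_(u in S) dot u x = \int[sigma]_(u in S) (- 1 * dot u x).
  rewrite /Rintegral; congr fine; apply: etrans (etrans _ sigmaN) _; last first.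
    by rewrite phiS; apply: eq_integral => u _ /=; rewrite /f NE.
  apply: eq_measure_integral => A mA _; have [_ sigmaQ] := sigmaU.
  by rewrite /= /pushforward sigmaQ// linearN/= mulmxN mulNmx opprK trmx1 mulmx1.
rewrite RintegralZl//; last exact: integrable_dot.
lra.
Qed.

Lemma mean_width_translate K x : K !=set0 -> compact K ->
  mean_width sigma (translate K x) = mean_width sigma K.
Proof.
move=> K0 cK; rewrite /mean_width; congr (2 * _).
rewrite (@eq_Rintegral _ _ _ sigma _
  (fun u : borel_space R n => support_function K u + dot (u : V) x)); last first.
  by move=> u _; rewrite support_translate.
rewrite RintegralD ?integral_dot ?addr0//.
- exact: borel_sphere.
- exact: integrable_support.
- exact: integrable_dot.
Qed.

Lemma mean_width_dilate K (a : R) : 0 <= a -> K !=set0 -> compact K ->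
  mean_width sigma (dilate a K) = a * mean_width sigma K.
Proof.
move=> a0 K0 cK; rewrite /mean_width mulrCA; congr (2 * _).
rewrite (@eq_Rintegral _ _ _ sigma _
  (fun u : borel_space R n => a * support_function K u)); last first.
  by move=> u _; rewrite support_dilate.
by rewrite RintegralZl//; [exact: borel_sphere|exact: integrable_support].
Qed.

(** If some [z] in [L] is separated from [K] by the direction [v], then
    [support_function L - support_function K] is at least a positive constant
    on a small cap around [v], and such a cap has positive measure. *)
Lemma mean_width_eq_sub K L : compact_convex K -> compact L -> K `<=` L ->
  mean_width sigma K = mean_width sigma L -> L `<=` K.
Proof.
move=> ccK cL KL WKL z Lz; apply: contrapT => Kz.
have [v v1 vz] := strict_separation ccK Kz.
have [K0 cK _] := ccK; have L0 : L !=set0 by exists z.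
have mS : measurable (S : set (borel_space R n)) by exact: borel_sphere.
have [r r0 Kr] := compact_norm_bounded cK.
pose M := r + eucl_norm z; have M0 : 0 < M by rewrite ltr_wpDr// eucl_norm_ge0.
pose e := (dot v z - support_function K v) / 2.
have e0 : 0 < e by rewrite divr_gt0// subr_gt0.
pose c := 1 - (e / M) ^+ 2 / 2.
have c1 : c < 1 by rewrite ltrBlDr ltrDl divr_gt0// exprn_gt0// divr_gt0.
pose g (u : borel_space R n) : R := support_function L u - support_function K u.
have g_ge u : cap v c u -> e <= g u.
  move=> [u1 /= cu]; rewrite lerBrDr.
  have uv : eucl_norm (u - v) <= e / M.
    rewrite le_eucl_norm; last by rewrite divr_ge0// ltW.
    move/eucl_sphereP: u1 => u1; move/eucl_sphereP: v1 => v1.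
    rewrite !dot_bilinear u1 v1 (dotC v u); move: cu; rewrite /c.
    by move: (dot u v) ((e / M) ^+ 2) => s t; lra.
  have uvM : eucl_norm (u - v) * M <= e by rewrite -ler_pdivlMr.
  apply: le_trans (dot_le_support u cL Lz).
  have hK : support_function K u <= support_function K v + eucl_norm (u - v) * r.
    apply: sub_support => // y Ky.
    have -> : dot u y = dot v y + dot (u - v) y by rewrite dotBl; ring.
    rewrite lerD ?dot_le_support// (le_trans (dot_le_norm _ _))//.
    by rewrite ler_wpM2l ?Kr// eucl_norm_ge0.
  have hz : dot v z - eucl_norm (u - v) * eucl_norm z <= dot u z.
    have := cauchy_schwarz (u - v) z; rewrite dotBl ler_norml => /andP[+ _].
    by lra.
  have -> : dot u z = dot v z + (dot u z - dot v z) by ring.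
  by move: uvM hK hz; rewrite /M /e mulrDr; lra.
have g_ge0 u : S u -> 0 <= g u by move=> _; rewrite subr_ge0 support_le.
have mg : measurable_fun (S : set (borel_space R n)) (EFin \o g).
  apply/measurable_EFinP; apply: measurable_funB.
    exact: measurable_funTS (measurable_support L0 cL).
  exact: measurable_funTS (measurable_support K0 cK).
have intg : (\int[sigma]_(u in S) (g u)%:E = 0)%E.
  rewrite -[LHS]fineK; last first.
    apply: integrable_fin_num => //.
    exact: integrableB (integrable_support L0 cL) (integrable_support K0 cK).
  congr EFin; rewrite -[LHS]/(\int[sigma]_(u in S) g u) RintegralB//.
  - by move: WKL; rewrite /mean_width; lra.
  - exact: integrable_support.
  - exact: integrable_support.
have capS : cap v c `<=` S by move=> u [].
have : (e%:E * sigma (cap v c) <= 0)%E.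
  rewrite -intg -integral_cst; last exact: borel_cap.
  apply: (@le_trans _ _ (\int[sigma]_(u in cap v c) (g u)%:E)%E).
    apply: ge0_le_integral => //.
    - exact: borel_cap.
    - by move=> u _; rewrite lee_fin ltW.
    - exact: measurable_funS mS capS mg.
  by apply: ge0_subset_integral => //; exact: borel_cap.
by rewrite leNgt mule_gt0// cap_measure_gt0.
Qed.

End MeanWidthProperties.

(** * Reflections and symmetric segments *)

Section Reflection.
Variables (R : realType) (n : nat).
Local Notation V := 'rV[R]_n.
Variable H : {vspace V}.
Implicit Types (x y h p : V) (A K : set V).

Lemma orth_projE h p : h \in H -> p \in orth_compl H -> orth_proj H (h + p) = h.
Proof.
move=> hH pH; rewrite /orth_proj linearD/= daddv_pi_id ?capv_orth_compl//.
suff -> : daddv_pi H (orth_compl H) p = 0 by rewrite addr0.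
have cap0 := capv_orth_compl H.
have pHH : p \in (H + orth_compl H)%VS by rewrite addv_orth_compl memvf.
have := daddv_pi_add cap0 pHH.
rewrite (daddv_pi_id (U := orth_compl H)) ?[(orth_compl H :&: H)%VS]capvC//.
by move=> /(congr1 (fun q => q - p)); rewrite addrK subrr.
Qed.

Lemma reflectionE h p : h \in H -> p \in orth_compl H -> reflection H (h + p) = h - p.
Proof.
move=> hH pH; rewrite /reflection orth_projE//.
by apply/rowP => j; rewrite !mxE; ring.
Qed.

Lemma orth_decomposition y : exists h p,
  [/\ h \in H, p \in orth_compl H & y = h + p].
Proof.
exists (orth_proj H y), (y - orth_proj H y); split.
- exact: orth_proj_mem.
- exact: sub_orth_proj_orth_compl.
- by rewrite addrC subrK.
Qed.

Lemma reflectionK : involutive (reflection H).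
Proof.
move=> y; have [h [p [hH pH ->]]] := orth_decomposition y.
by rewrite reflectionE// reflectionE ?rpredN// opprK.
Qed.

Lemma reflectionD x y : reflection H (x + y) = reflection H x + reflection H y.
Proof.
rewrite /reflection /orth_proj linearD/=.
by apply/rowP => j; rewrite !mxE; ring.
Qed.

Lemma reflectionZ (a : R) x : reflection H (a *: x) = a *: reflection H x.
Proof.
rewrite /reflection /orth_proj linearZ/=.
by apply/rowP => j; rewrite !mxE; ring.
Qed.

Lemma eucl_norm_reflection x : eucl_norm (reflection H x) = eucl_norm x.
Proof.
have [h [p [hH pH ->]]] := orth_decomposition x; rewrite reflectionE//.
have hp : dot h p = 0 by exact: (memv_orth_complP _ _ pH).
by rewrite /eucl_norm !dot_bilinear (dotC p h) hp; congr Num.sqrt; ring.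
Qed.

Lemma symmetric_setP A :
  symmetric_set H A <-> forall y, A y -> A (reflection H y).
Proof.
split=> [sA y Ay|sA]; first by rewrite -sA; exists y.
apply/seteqP; split=> [_ [y Ay <-]|y Ay]; first exact: sA.
by exists (reflection H y); [exact: sA|exact: reflectionK].
Qed.

Lemma symmetric_add_ball K (r : R) : symmetric_set H K ->
  symmetric_set H (minkowski_add K (dilate r (eucl_ball R n))).
Proof.
move=> /symmetric_setP sK; apply/symmetric_setP => _ [y Ky [_ [b b1 <-] <-]].
exists (reflection H y); first exact: sK.
exists (r *: reflection H b); last by rewrite reflectionD reflectionZ.
by exists (reflection H b); rewrite // /eucl_ball/= eucl_norm_reflection.
Qed.

Lemma symmetric_bigcap (K_ : nat -> set V) : (forall k, symmetric_set H (K_ k)) ->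
  symmetric_set H (\bigcap_k K_ k).
Proof.
move=> sK; apply/symmetric_setP => y Ky k _.
by have /symmetric_setP := sK k; apply; exact: Ky.
Qed.

Definition parallelogram (a x : V) : set V :=
  minkowski_add (centered_segment a) (centered_segment x).

Lemma symmetric_parallelogram h a x :
  h \in H -> a \in orth_compl H -> x \in orth_compl H ->
  symmetric_set H (translate (parallelogram a x) h).
Proof.
move=> hH aH xH; apply/symmetric_setP => _ [_ [_ /centered_segmentP[s s1 ->]
  [_ /centered_segmentP[r r1 ->] <-]] <-].
rewrite addrC reflectionE ?rpredD ?rpredZ//.
exists ((- s) *: a + (- r) *: x); last by rewrite !scaleNr opprD addrC.
exists (- s *: a); first by apply/centered_segmentP; exists (- s) => //; lra.
by exists (- r *: x) => //; apply/centered_segmentP; exists (- r) => //; lra.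
Qed.

(** The endpoints [h + p] and [h + q] satisfy [- p = (1 - t) p + t q] and
    [- q = (1 - s) p + s q] because their mirror images lie in the segment, and
    these two equations force [p + q = 0]. *)
Lemma symmetric_segment_centered A h : line_segment A -> symmetric_set H A ->
  h \in H -> A `<=` translate [set` orth_compl H] h ->
  exists2 b, A (b + h) & A = translate (centered_segment b) h.
Proof.
move=> [P [Q AE]] /symmetric_setP sA hH AH.
have AP : A P.
  by rewrite AE; exists 0; rewrite /= ?in_itv/= ?lexx ?ler01// subr0 scale1r scale0r addr0.
have AQ : A Q.
  by rewrite AE; exists 1; rewrite /= ?in_itv/= ?lexx ?ler01// subrr scale1r scale0r add0r.
have [p pH pP] := AH _ AP; have [q qH qQ] := AH _ AQ.
have /= : A (h - p) by rewrite -(reflectionE hH pH) addrC pP; exact: sA.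
rewrite {1}AE -pP -qQ => -[t /=]; rewrite in_itv/= => /andP[t0 t1] Et.
have /= : A (h - q) by rewrite -(reflectionE hH qH) addrC qQ; exact: sA.
rewrite {1}AE -pP -qQ => -[s /=]; rewrite in_itv/= => /andP[s0 s1] Es.
have {}Et : t *: (p + q) = (2 * t - 2) *: p.
  apply/rowP => j; move/rowP/(_ j): Et; rewrite !mxE.
  by move: (p 0 j) (q 0 j) (h 0 j) => pj qj hj Ej; lra.
have {}Es : (1 + s) *: (p + q) = (2 * s) *: p.
  apply/rowP => j; move/rowP/(_ j): Es; rewrite !mxE.
  by move: (p 0 j) (q 0 j) (h 0 j) => pj qj hj Ej; lra.
have pq : p + q = 0.
  have [s_eq0|s_neq0] := eqVneq s 0.
    by move: Es; rewrite s_eq0 addr0 mulr0 scale1r scale0r.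
  have : (2 * (1 + s - t)) *: (p + q) = 0.
    apply/rowP => j; move/rowP/(_ j): Et; move/rowP/(_ j): Es; rewrite !mxE.
    move: (p 0 j) (q 0 j) => pj qj Es Et.
    transitivity ((2 - 2 * t) * ((1 + s) * (pj + qj)) + 2 * s * (t * (pj + qj))).
      by ring.
    by rewrite Es Et; ring.
  move/eqP; rewrite scaler_eq0 => /orP[/eqP c0|/eqP pq0]; last exact: pq0.
  have s_gt0 : 0 < s by rewrite lt_neqAle eq_sym s_neq0.
  have : 0 < 2 * (1 + s - t) by lra.
  by rewrite c0 ltxx.
have qE : q = - p by apply/eqP; rewrite -addr_eq0 addrC pq.
exists p; first by rewrite pP.
rewrite AE -pP -qQ qE; apply/seteqP; split=> [y [r /=]|_ [_ /centered_segmentP[r r1 ->] <-]].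
  rewrite in_itv/= => r01 <-; exists ((1 - 2 * r) *: p).
    by apply/centered_segmentP; exists (1 - 2 * r) => //; lra.
  by apply/rowP => j; rewrite !mxE; ring.
exists ((1 - r) / 2); first by rewrite /= in_itv/=; lra.
by apply/rowP => j; rewrite !mxE; field.
Qed.

End Reflection.

(** * Symmetrizations of compact convex sets *)

Section CompactConvexSymmetrization.
Variables (R : realType) (n : nat).
Local Notation V := 'rV[R]_n.
Implicit Types (x y a b h : V) (K L : set V).
Variable sigma : probability (borel_space R n) R.
Hypothesis sigmaU : uniform_on_sphere sigma.

Lemma centered_segmentZ (l : R) b :
  centered_segment (l *: b) = dilate `|l| (centered_segment b).
Proof.
apply/seteqP; split=> [_ /centered_segmentP[s s1 ->]|_ [_ /centered_segmentP[s s1 ->] <-]].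
  exists ((Num.sg l * s) *: b); last first.
    by rewrite !scalerA mulrA [_ * Num.sg l]mulrC -numEsg mulrC.
  apply/centered_segmentP; exists (Num.sg l * s) => //.
  by have [_|_|_] := sgrP l; lra.
apply/centered_segmentP; exists (Num.sg l * s).
  by have [_|_|_] := sgrP l; lra.
by rewrite !scalerA mulrAC -normrEsg.
Qed.

Lemma mean_width_segment h (l : R) b :
  mean_width sigma (translate (centered_segment (l *: b)) h) =
  `|l| * mean_width sigma (centered_segment b).
Proof.
have [b0 bc _] := compact_convex_segment b.
have [lb0 lbc _] := compact_convex_segment (l *: b).
by rewrite (mean_width_translate sigmaU)// centered_segmentZ mean_width_dilate.
Qed.

Lemma mean_width_segment_neq0 a : a != 0 -> mean_width sigma (centered_segment a) != 0.
Proof.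
move=> a0; apply: contra_neq a0 => Wa.
have [_ ca _] := compact_convex_segment a.
have sub : centered_segment 0 `<=` centered_segment a.
  move=> _ /centered_segmentP[s _ ->]; apply/centered_segmentP.
  by exists 0; [lra|rewrite scaler0 scale0r].
have W0 : mean_width sigma (centered_segment 0) = mean_width sigma (centered_segment a).
  rewrite Wa -(scale0r a) centered_segmentZ mean_width_dilate ?normr_ge0//.
    by rewrite normr0 mul0r.
  by have [] := compact_convex_segment a.
have aa : centered_segment a a.
  by apply/centered_segmentP; exists 1; [lra|rewrite scale1r].
have := mean_width_eq_sub sigmaU (compact_convex_segment 0) ca sub W0 aa.
by move=> /centered_segmentP[s _ ->]; rewrite scaler0.
Qed.

Variables (H : {vspace V}) (D : set V -> set V).
Hypothesis Dsym : symmetrization CompactConvexSets H D.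
Hypothesis Dmono : monotonic_symmetrization CompactConvexSets D.
Hypothesis Dinv : invariant_on_symmetric CompactConvexSets H D.
Hypothesis DW : mean_width_preserving CompactConvexSets sigma D.
Hypothesis Dcan : maps_orthogonal_segments H D.

Let cc_segment a h : compact_convex (translate (centered_segment a) h).
Proof. exact/compact_convex_translate/compact_convex_segment. Qed.

(** The parallelogram is a symmetric set containing the given segment, hence
    also its image. *)
Lemma image_segment h a x :
  h \in H -> a \in orth_compl H -> x \in orth_compl H ->
  exists al be : R, `|be| <= 1 /\
    D (translate (centered_segment a) (h + x)) =
    translate (centered_segment (al *: a + be *: x)) h.
Proof.
move=> hH aH xH; set sg := translate _ _.
pose box := translate (parallelogram a x) h.
have ccbox : compact_convex box.
  by apply/compact_convex_translate/compact_convex_add; exact: compact_convex_segment.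
have Dbox : D box = box by apply: Dinv; split=> //; exact: symmetric_parallelogram.
have sg_box : sg `<=` box.
  move=> _ [y ay <-]; exists (y + x); last by rewrite -addrA (addrC x).
  exists y => //; exists x => //; apply/centered_segmentP.
  by exists 1; [lra|rewrite scale1r].
have Dsg_box : D sg `<=` box by rewrite -Dbox; apply: Dmono => //; exact: cc_segment.
have box_orth : box `<=` translate [set` orth_compl H] h.
  move=> _ [y [_ /centered_segmentP[s _ ->] [_ /centered_segmentP[r _ ->] <-]] <-].
  by exists (s *: a + r *: x) => //=; rewrite rpredD ?rpredZ.
have [_ sDsg] : symmetric_members CompactConvexSets H (D sg).
  by apply: Dsym; exact: cc_segment.
have lDsg : line_segment (D sg).
  apply: Dcan.
    exists (- a + (h + x)), (a + (h + x)); apply/seteqP; split.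
      move=> _ [_ /centered_segmentP[s s1 ->] <-].
      exists ((1 + s) / 2); first by rewrite /= in_itv/=; lra.
      by apply/rowP => j; rewrite !mxE; field.
    move=> y [t /=]; rewrite in_itv/= => t01 <-.
    exists ((2 * t - 1) *: a); last by apply/rowP => j; rewrite !mxE; ring.
    by apply/centered_segmentP; exists (2 * t - 1) => //; lra.
  by exists h; exact: subset_trans box_orth.
have [b Db DE] := symmetric_segment_centered lDsg sDsg hH (subset_trans Dsg_box box_orth).
have [_ [_ /centered_segmentP[s s1 ->] [_ /centered_segmentP[r r1 ->] <-]] /addIr bE] :=
  Dsg_box _ Db.
by exists s, r; rewrite bE; split=> //; rewrite ler_norml.
Qed.

(** The [x]-component of the direction [b] of the image tends to zero when the
    segment is lengthened, while lengthening only rescales [b]. *)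
Lemma image_segment_direction h a x b (t : R) :
  h \in H -> a \in orth_compl H -> x \in orth_compl H -> a != 0 -> 1 <= t ->
  D (translate (centered_segment a) (h + x)) = translate (centered_segment b) h ->
  exists al be : R, `|be| * t <= 1 /\ b = al *: a + be *: x.
Proof.
move=> hH aH xH a0 t1 DE.
have t0 : 0 < t by rewrite (lt_le_trans ltr01).
have [al [be [be1 DEt]]] := image_segment hH (memvZ t aH) xH.
set c := al *: _ + _ in DEt.
have sub : translate (centered_segment b) h `<=` translate (centered_segment c) h.
  rewrite -DE -DEt; apply: Dmono; try exact: cc_segment.
  move=> _ [_ /centered_segmentP[s s1 ->] <-]; exists (s *: a) => //.
  apply/centered_segmentP; exists (s / t); last by rewrite scalerA divfK ?gt_eqF.
  by rewrite ler_pdivlMr// ler_pdivrMr// ; lra.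
have [|_ /centered_segmentP[l l1 ->] /addIr bE] := sub (b + h).
  by exists b => //; apply/centered_segmentP; exists 1; [lra|rewrite scale1r].
have lt : `|l| * t = 1.
  have Wa := DW (cc_segment a (h + x)); have Wt := DW (cc_segment (t *: a) (h + x)).
  rewrite DE -bE mean_width_segment -[a]scale1r mean_width_segment normr1 mul1r in Wa.
  rewrite DEt -[c]scale1r !mean_width_segment normr1 mul1r gtr0_norm// in Wt.
  apply: (mulIf (mean_width_segment_neq0 a0)).
  by rewrite -mulrA -Wt Wa mul1r.
exists (l * al * t), (l * be); split.
  by rewrite normrM mulrAC lt mul1r.
by rewrite -bE /c scalerDr !scalerA.
Qed.

(** The direction [b] of the image is a multiple of [a]: its component orthogonal
    to [a] comes from an arbitrarily small multiple of [x].  Equality of mean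
    widths then makes the factor a sign. *)
Lemma mem_image_segment h a x :
  h \in H -> a \in orth_compl H -> x \in orth_compl H ->
  D (translate (centered_segment a) (h + x)) (h + a).
Proof.
move=> hH aH xH; have [al [be [_ DE]]] := image_segment hH aH xH.
move: (al *: a + be *: x) DE => b DE {al be}.
have [a0|a0] := eqVneq a 0.
  rewrite DE a0 addrC; exists 0 => //.
  by apply/centered_segmentP; exists 0; [lra|rewrite scale0r].
have b_dir := image_segment_direction hH aH xH a0 _ DE.
have aa := dot_gt0 a0.
pose s := dot b a / dot a a; pose w := b - s *: a.
have wa : dot w a = 0 by rewrite /w dotBl dotZl /s divfK ?subrr ?gt_eqF.
have wb : dot w w = dot w b by rewrite {2}/w dotBr dotZr wa mulr0 subr0.
have w0 : w = 0.
  apply/eqP; apply: contraT => /dot_gt0 ww.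
  (* b = al a + be x gives <w, w> = be <w, x>, so <w, w> t <= |<w, x>|, which
     fails as soon as t exceeds |<w, x>| / <w, w> *)
  pose t := 1 + `|dot w x| / dot w w.
  have t1 : 1 <= t by rewrite lerDl divr_ge0 ?normr_ge0 ?ltW.
  have [al [be [bet bE]]] := b_dir _ t1.
  have wwE : dot w w = be * dot w x by rewrite wb bE dotDr !dotZr wa mulr0 add0r.
  have : dot w w * t <= `|dot w x|.
    rewrite -[dot w w]gtr0_norm// wwE normrM mulrAC.
    by rewrite ler_piMl// normr_ge0.
  by rewrite /t mulrDr mulr1 mulrCA divff ?gt_eqF// mulr1 gerDr leNgt ww.
have bE : b = s *: a by apply/eqP; rewrite -subr_eq0; apply/eqP.
have s1 : `|s| = 1.
  have := DW (cc_segment a (h + x)).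
  rewrite DE bE mean_width_segment -[a in RHS]scale1r mean_width_segment normr1.
  exact: (mulIf (mean_width_segment_neq0 a0)).
have ss : s * s = 1 by rewrite -expr2 -real_normK ?num_real// s1 expr1n.
rewrite DE bE addrC; exists a => //; apply/centered_segmentP; exists s.
  by rewrite -ler_norml s1.
by rewrite scalerA ss scale1r.
Qed.

(** A symmetric set is the union of the segments joining its points to their
    mirror images, so its translate is mapped onto a superset of it; equality
    follows from the preservation of the mean width. *)
Lemma compact_convex_translate_invariant K x :
  symmetric_members CompactConvexSets H K -> x \in orth_compl H ->
  D (translate K x) = K.
Proof.
move=> [ccK /symmetric_setP sK] xH; have [K0 cK /convex_setE vK] := ccK.
have ccKx : compact_convex (translate K x) by exact: compact_convex_translate.
have KD : K `<=` D (translate K x).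
  move=> y; have [h [a [hH aH ->]]] := orth_decomposition H y => Kha.
  have Kh_a : K (h - a) by rewrite -(reflectionE hH aH); exact: sK.
  apply: (Dmono (cc_segment a (h + x)) ccKx); last exact: mem_image_segment.
  move=> _ [_ /centered_segmentP[s s1 ->] <-]; exists (h + s *: a).
    have -> : h + s *: a =
        ((1 + s) / 2) *: (h + a) + (1 - (1 + s) / 2) *: (h - a).
      by apply/rowP => j; rewrite !mxE; field.
    by apply: vK => //; lra.
  by rewrite addrCA addrA.
have [[_ cD _] _] := Dsym ccKx.
apply/seteqP; split=> //; apply: (mean_width_eq_sub sigmaU ccK cD KD).
by rewrite (DW ccKx) (mean_width_translate sigmaU).
Qed.

End CompactConvexSymmetrization.

(** * Convex bodies and the natural extension *)

Section NaturalExtension.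
Variables (R : realType) (n : nat).
Local Notation V := 'rV[R]_n.
Implicit Types (x y z : V) (A K L : set V).

Definition parallel_body K (r : R) : set V :=
  minkowski_add K (dilate r (eucl_ball R n)).

Lemma sub_parallel_body K (r : R) : K `<=` parallel_body K r.
Proof.
move=> y Ky; exists y => //; exists 0; last by rewrite addr0.
by exists 0; rewrite ?scaler0// /eucl_ball/= /eucl_norm dot0l sqrtr0.
Qed.

Lemma parallel_bodyS K L (r : R) : K `<=` L -> parallel_body K r `<=` parallel_body L r.
Proof. by move=> KL _ [y /KL Ly [b bB <-]]; exists y => //; exists b. Qed.

Lemma le_parallel_body K (r s : R) : 0 < s -> 0 <= r <= s ->
  parallel_body K r `<=` parallel_body K s.
Proof.
move=> s0 /andP[r0 rs] _ [y Ky [_ [b b1 <-] <-]].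
exists y => //; exists (r *: b) => //; exists ((r / s) *: b).
  have rs0 : 0 <= r / s by rewrite divr_ge0// ltW.
  have rs1 : r / s <= 1 by rewrite ler_pdivrMr// mul1r.
  have := compact_convex_ball R n => -[_ _ /convex_setE vB].
  have := vB b 0 (r / s); rewrite scaler0 addr0; apply => //; first exact/andP.
  by rewrite /eucl_ball/= /eucl_norm dot0l sqrtr0.
by rewrite scalerA mulrCA divff ?mulr1// gt_eqF.
Qed.

Lemma compact_convex_parallel_body K (r : R) : compact_convex K ->
  compact_convex (parallel_body K r).
Proof.
by move=> cK; apply: compact_convex_add => //; apply: compact_convex_dilate;
  exact: compact_convex_ball.
Qed.

Lemma convex_body_parallel_body K (r : R) : 0 < r -> compact_convex K ->
  convex_body (parallel_body K r).
Proof.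
move=> r0 ccK; split; first exact: compact_convex_parallel_body.
have [[y Ky] _ _] := ccK; exists y.
have oU : open [set z : V | dot (z - y) (z - y) < r ^+ 2].
  have : open ((fun z => dot (z - y) (z - y)) @^-1` [set s | s < r ^+ 2]).
    apply: open_comp; last exact: open_lt.
    move=> z _; apply: (@continuous_comp _ _ _ (fun z => z - y) (fun z => dot z z)).
      by apply: (@cvgB _ _ _ (nbhs z)); [exact: cvg_id|exact: cvg_cst].
    exact: dot_diag_continuous.
  by [].
suff : [set z : V | dot (z - y) (z - y) < r ^+ 2] `<=` (parallel_body K r)°.
  by apply; rewrite /= subrr dot0l exprn_gt0.
rewrite -open_subsetE//.
move=> z /= /ltW zy; exists y => //; exists (z - y); last by rewrite addrC subrK.
exists (r^-1 *: (z - y)); last by rewrite scalerA divff ?scale1r// gt_eqF.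
rewrite /eucl_ball/= le_eucl_norm// expr1n dotZl dotZr mulrA -expr2 exprVn.
by rewrite ler_pdivrMl ?exprn_gt0// mulr1.
Qed.

Lemma convex_body_translate K x : convex_body K -> convex_body (translate K x).
Proof.
move=> [ccK [y Ky]]; split; first exact: compact_convex_translate.
exists (y + x); pose U := (fun z : V => z - x) @^-1` K°.
have oU : open U.
  apply: open_comp; last exact: open_interior.
  by move=> z _; apply: (@cvgB _ _ _ (nbhs z)); [exact: cvg_id|exact: cvg_cst].
suff : U `<=` (translate K x)° by apply; rewrite /U/= addrK.
rewrite -open_subsetE//.
by move=> z /= /interior_subset Kzx; exists (z - x) => //; rewrite subrK.
Qed.

Lemma natural_extensionE (D : set V -> set V) K :
  natural_extension D K = \bigcap_k D (parallel_body K k.+1%:R^-1).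
Proof.
apply/seteqP; split=> y Dy; first by move=> k _; exact: (Dy k.+1).
by move=> [//|k] _; exact: Dy.
Qed.

Lemma exists_invn_lt (e : R) : 0 < e -> exists k, k.+1%:R^-1 < e.
Proof. by move=> /ltr_add_invr[k]; rewrite add0r => ke; exists k. Qed.

Variables (H : {vspace V}) (sigma : probability (borel_space R n) R).
Hypothesis sigmaU : uniform_on_sphere sigma.

Variable D : set V -> set V.
Hypothesis Dsym : symmetrization ConvexBodies H D.
Hypothesis Dmono : monotonic_symmetrization ConvexBodies D.
Hypothesis Dinv : invariant_on_symmetric ConvexBodies H D.
Hypothesis DW : mean_width_preserving ConvexBodies sigma D.

Section FixedSet.
Variable K : set V.
Hypothesis ccK : compact_convex K.

Let r k : R := k.+1%:R^-1.
Let D_ k := D (parallel_body K (r k)).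

Let r_gt0 k : 0 < r k. Proof. by rewrite invr_gt0. Qed.

Let body k : convex_body (parallel_body K (r k)).
Proof. exact: convex_body_parallel_body. Qed.

Let ccD k : compact_convex (D_ k).
Proof. by have [[]] := Dsym (body k). Qed.

Let D_decreasing j k : (j <= k)%N -> D_ k `<=` D_ j.
Proof.
move=> jk; apply: (Dmono (body k) (body j)); apply: le_parallel_body => //.
by rewrite ltW//= lef_pV2 ?posrE// ler_nat.
Qed.

Let D_cap0 : \bigcap_k D_ k !=set0.
Proof.
apply/set0P/eqP => D0.
have [||k] := @decreasing_compact _ _ D_ set0 _ D_decreasing open0.
- by move=> k; have [] := ccD k.
- by rewrite D0.
- by move=> Dk0; have [[y /Dk0]] := ccD k.
Qed.

Lemma natural_extension_symmetric_member :
  symmetric_members CompactConvexSets H (natural_extension D K).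
Proof.
rewrite natural_extensionE; split; first exact: compact_convex_bigcap.
by apply: symmetric_bigcap => k; have [] := Dsym (body k).
Qed.

(** The [m]-th set of the intersection has the mean width of [K] up to an excess
    of at most [2 / m], and the support functions converge uniformly to that of
    the intersection. *)
Lemma natural_extension_mean_width :
  mean_width sigma (natural_extension D K) = mean_width sigma K.
Proof.
have [K0 cK _] := ccK; have [cap0 cap_c _] := compact_convex_bigcap ccD D_cap0.
have Dk k : [/\ D_ k !=set0, compact (D_ k) &
                mean_width sigma (D_ k) = mean_width sigma (parallel_body K (r k))].
  by have [? ? _] := ccD k; rewrite -(DW (body k)).
rewrite natural_extensionE; apply/eqP; rewrite eq_le; apply/andP; split.
  apply/ler_addgt0Pr => e e0.
  have [k /ltW rk] : exists k, r k < e / 2 by apply: exists_invn_lt; rewrite divr_gt0.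
  have [Dk0 Dkc WDk] := Dk k.
  apply: (@le_trans _ _ (mean_width sigma (D_ k))).
    by apply: mean_width_le => // y; apply.
  have [pb0 pbc _] := (body k).1; rewrite WDk.
  apply: le_trans (mean_width_le_add (e := r k) sigmaU pb0 pbc K0 cK _) _.
    by move=> u uS; apply: support_add_ball => //; exact: ltW.
  by rewrite lerD2l; lra.
apply/ler_addgt0Pr => e e0.
have [|k hk] := support_bigcap (eps := e / 2) ccD D_decreasing D_cap0.
  by rewrite divr_gt0.
have [Dk0 Dkc WDk] := Dk k.
apply: (@le_trans _ _ (mean_width sigma (D_ k))).
  by rewrite WDk; apply: mean_width_le (sub_parallel_body _) => //; have [[]] := body k.
apply: le_trans (mean_width_le_add sigmaU Dk0 Dkc cap0 cap_c hk) _.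
by rewrite lerD2l; lra.
Qed.

(** No point outside [K] lies in all the parallel bodies, by separation. *)
Lemma natural_extension_symmetric : symmetric_set H K -> natural_extension D K = K.
Proof.
move=> sK; rewrite natural_extensionE.
have [K0 cK _] := ccK.
have DE k : D (parallel_body K k.+1%:R^-1) = parallel_body K (r k).
  by apply: Dinv; split; [exact: body|exact: symmetric_add_ball].
apply/seteqP; split=> [z Dz|y Ky k _]; last by rewrite DE; exact: sub_parallel_body.
apply: contrapT => Kz; have [u u1] := strict_separation ccK Kz.
rewrite -subr_gt0 => /exists_invn_lt[k rk].
have := Dz k I; rewrite DE => pz.
have [[_ pc _] _] := body k.
have := le_trans (dot_le_support u pc pz) (support_add_ball (ltW (r_gt0 k)) u1 K0 cK).
by move: rk; rewrite -/(r k); lra.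
Qed.

(** [D K] is contained in every defining set of the natural extension; equality
    of the mean widths excludes a strict inclusion. *)
Lemma natural_extension_body : convex_body K -> natural_extension D K = D K.
Proof.
move=> bK; have [[_ cD _] _] := natural_extension_symmetric_member.
have [[ccDK _] _] := Dsym bK.
have DK : D K `<=` natural_extension D K.
  by rewrite natural_extensionE => y Dy k _; apply: Dmono Dy => //;
    [exact: body|exact: sub_parallel_body].
apply/seteqP; split=> //; apply: (mean_width_eq_sub sigmaU ccDK cD DK).
by rewrite natural_extension_mean_width DW.
Qed.

End FixedSet.

Lemma natural_extension_monotonic :
  monotonic_symmetrization CompactConvexSets (natural_extension D).
Proof.
move=> K L cK cL KL; rewrite !natural_extensionE => y Dy k _.
apply: Dmono (Dy k I); last exact: parallel_bodyS;
  by apply: convex_body_parallel_body; rewrite ?invr_gt0.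
Qed.

End NaturalExtension.

Unset Implicit Arguments.

(** * Translations of symmetric sets *)

Theorem theorem5p2 (R : realType) (n i : nat) (H : {vspace 'rV[R]_n})
  (sigma : probability (borel_space R n) R) (F : body_class)
  (D : set 'rV[R]_n -> set 'rV[R]_n) :
  (i < n)%N -> (\dim H = i)%N ->
  uniform_on_sphere sigma ->
  symmetrization F H D ->
  monotonic_symmetrization F D ->
  invariant_on_symmetric F H D ->
  mean_width_preserving F sigma D ->
  canonical_symmetrization F H D ->
  forall (K : set 'rV[R]_n) (x : 'rV[R]_n),
    symmetric_members F H K -> x \in orth_compl H -> D (translate K x) = K.
Proof.
move=> _ _ sigmaU Dsym Dmono Dinv DW.
case: F Dsym Dmono Dinv DW => /= Dsym Dmono Dinv DW Dcan K x sK xH.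
  exact: (compact_convex_translate_invariant sigmaU Dsym Dmono Dinv DW Dcan).
have [bK symK] := sK; have ccK : compact_convex K by case: bK.
rewrite -(natural_extension_body sigmaU Dsym Dmono DW); last 2 first.
- exact: compact_convex_translate.
- exact: convex_body_translate.
apply: (compact_convex_translate_invariant sigmaU _ _ _ _ Dcan) => //.
- by move=> L cL; exact: (natural_extension_symmetric_member Dsym Dmono cL).
- exact: natural_extension_monotonic.
- by move=> L [cL sL]; exact: (natural_extension_symmetric Dinv cL sL).
- by move=> L cL; exact: (natural_extension_mean_width sigmaU Dsym Dmono DW cL).
Qed.
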